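(* Let $\mu$ be the measure on $\mathbb{R}^q$ constructed in the context from the graph $\mathcal{G}$, the maps $(T_{i,j})$, the positive probability vector $\chi$ and the transition matrix $P=\begin{pmatrix}P_1&P_3\\P_4&P_2\end{pmatrix}$ (with $N\times N$ blocks). (1) Assume that $P_1$ is irreducible and that for every $i\in\Psi$ both sets $\{j\in\Psi:p_{i,j}>0\}$ and $\{j\in\Psi:p_{i^+,j^+}>0\}$ have at least two elements. Then $\mu$ is reducible if and only if for every $i\in\Psi$ at least one of the following holds: (a) $p_{i,j}+p_{i,j^+}=p_{i^+,j}+p_{i^+,j^+}$ for every $j\in\Psi$; (b) $\chi_{i^+}I_{1,\sigma}=\chi_i I_{2,\sigma}$ for every $\sigma\in\mathcal{S}^*(i)$. (2) Assume that $P_1$ and $P_2$ are irreducible and $P_4=\mathbf{0}$; that for every $i\in\Psi$ both sets $\{j\in\Psi:p_{i,j}>0\}$ and $\{j\in\Psi:p_{i^+,j^+}>0\}$ have at least two elements; and that for every $(i,j)\in\Psi^2$ either $\mathcal{M}_{i,j}=\emptyset$ or $\mathcal{M}_{i,j}=\{(i,j),(i,j^+),(i^+,j^+)\}$. Then $\mu$ is reducible if and only if $p_{i,j}+p_{i,j^+}=p_{i^+,j^+}$ for every $(i,j)\in\mathcal{S}_2$.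
   Context: Fix integers $q\ge1$, $N\ge2$. Let $\Psi=\{1,\ldots,N\}$, $\Omega=\{1,\ldots,2N\}$, $i^+:=i+N$ for $i\in\Psi$. Let $\mathcal{G}$ be a directed graph with vertex set $\Omega$, with at most one directed edge from any vertex to any vertex and at least one edge leaving each vertex. Let $G_1=\Omega$; for $k\ge2$, $G_k$ is the set of words $\sigma\in\Omega^k$ such that there is an edge from $\sigma_h$ to $\sigma_{h+1}$ for $1\le h\le k-1$; $G_\infty$ is the set of sequences in $\Omega^{\mathbb{N}}$ with the same property for all $h\ge1$; $G^*=\bigcup_k G_k$. For $(i,j)\in\Psi^2$, $\mathcal{M}_{i,j}:=\{(i,j),(i,j^+),(i^+,j),(i^+,j^+)\}\cap G_2$. For a finite or infinite word $\sigma$ over $\Psi$, $\mathcal{T}(\sigma)$ is the set of words $\widetilde\sigma$ over $\Omega$ of the same length with $\widetilde\sigma_h\in\{\sigma_h,\sigma_h^+\}$ for all $h$. Put $\mathcal{S}_1=\Psi$, $\mathcal{S}_k=\{\sigma\in\Psi^k:\mathcal{T}(\sigma)\cap G_k\ne\emptyset\}$ for $k\ge2$, $\mathcal{S}_\infty=\{\sigma\in\Psi^{\mathbb{N}}:\mathcal{T}(\sigma)\cap G_\infty\neq\emptyset\}$, $\mathcal{S}^*=\bigcup_{k\ge1}\mathcal{S}_k$, and $\Gamma(\sigma)=G_n\cap\mathcal{T}(\sigma)$ for $\sigma\in\mathcal{S}_n$. For $i\in\Psi$, $\mathcal{S}_n(i)=\{\sigma\in\mathcal{S}_n:\sigma_n=i\}$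 and $\mathcal{S}^*(i)=\bigcup_{n\ge1}\mathcal{S}_n(i)$. $\sigma|_k$ denotes the initial segment of length $k$. Let $J_i$, $i\in\Psi$, be non-empty, pairwise disjoint compact subsets of $\mathbb{R}^q$ with $\overline{\mathrm{int}(J_i)}=J_i$, and $J_{i^+}:=J_i$. For $(i,j)\in\mathcal{S}_2$ let $T_{i,j}$ be a contractive similarity of $\mathbb{R}^q$ with ratio $s_{i,j}$, and let $T_{\widetilde i,\widetilde j}:=T_{i,j}$ (hence $s_{\widetilde i,\widetilde j}=s_{i,j}$) for all $(\widetilde i,\widetilde j)\in\mathcal{M}_{i,j}$. Assume that $\bigcup_{j:(i,j)\in\mathcal{S}_2}T_{i,j}(J_j)\subset J_i$ for every $i\in\Psi$, and that the sets $T_{i,j}(J_j)$, $(i,j)\in\mathcal{S}_2$, are pairwise disjoint. For $\sigma\in\mathcal{S}_n\cup G_n$ let $T_\sigma=\mathrm{id}$ if $n=1$, $T_\sigma=T_{\sigma_1,\sigma_2}\circ\cdots\circ T_{\sigma_{n-1},\sigma_n}$ if $n>1$, and $J_\sigma=T_\sigma(J_{\sigma_n})$. Let $K=\bigcap_{k\ge1}\bigcup_{\sigma\in\mathcal{S}_k}J_\sigma$. Let $\chi=(\chi_i)_{i=1}^{2N}$ be a probability vector with all entries positive and $P=(p_{i,j})_{i,j=1}^{2N}$ a row-stochastic matrix with $p_{i,j}>0$ iff $(i,j)\in G_2$. For $\widetilde\sigma\in G_n$ put $p_{\widetilde\sigma}=1$ if $n=1$ and $p_{\widetilde\sigma}=p_{\widetilde\sigma_1,\widetilde\sigma_2}\cdots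 p_{\widetilde\sigma_{n-1},\widetilde\sigma_n}$ if $n>1$. Let $\nu$ be the unique Borel probability measure on $G_\infty$ with $\nu(\{\widetilde\tau\in G_\infty:\widetilde\tau|_n=\widetilde\sigma\})=\chi_{\widetilde\sigma_1}p_{\widetilde\sigma}$ for all $n$ and $\widetilde\sigma\in G_n$. Let $\pi:G_\infty\to K$, $\pi(\widetilde\sigma)$ being the unique point of $\bigcap_k J_{\widetilde\sigma|_k}$, and $\mu:=\nu\circ\pi^{-1}$. Then $\mu(J_\sigma)=\sum_{\widetilde\sigma\in\Gamma(\sigma)}\chi_{\widetilde\sigma_1}p_{\widetilde\sigma}$ for $\sigma\in\mathcal{S}^*$. For $\sigma\in\mathcal{S}_n(i)$: $I_{1,\sigma}:=\sum_{\widetilde\sigma\in\Gamma(\sigma),\,\widetilde\sigma_n=i}\chi_{\widetilde\sigma_1}p_{\widetilde\sigma}$ and $I_{2,\sigma}:=\sum_{\widetilde\sigma\in\Gamma(\sigma),\,\widetilde\sigma_n=i^+}\chi_{\widetilde\sigma_1}p_{\widetilde\sigma}$. Let $\pi_1:\mathcal{S}_\infty\to K$ be the bijection sending $\sigma$ to the unique point of $\bigcap_k J_{\sigma|_k}$. The measure $\mu$ is called reducible if $\mu=\nu_1\circ\pi_1^{-1}$ for the Markov-type measure $\nu_1$ on $\mathcal{S}_\infty$ associated with some $N\times N$ transition (row-stochastic) matrix $(\widetilde p_{i,j})$ and some initial probability vector $(\widetilde\chi_i)_{i=1}^N$, i.e. $\nu_1(\{\tau\in\mathcal{S}_\infty:\tau|_n=\sigma\})=\widetilde\chi_{\sigma_1}\widetilde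 p_{\sigma_1,\sigma_2}\cdots\widetilde p_{\sigma_{n-1},\sigma_n}$ for all $n\geq 1$ and $\sigma\in\Psi^n$. *)

(* Defs.v *)
From HB Require Import structures.
From mathcomp Require Import all_boot all_order all_algebra.
From mathcomp Require Import all_classical all_reals all_analysis.

Set Implicit Arguments.
Unset Strict Implicit.
Unset Printing Implicit Defensive.

Import Order.TTheory GRing.Theory Num.Theory.
Import numFieldNormedType.Exports.

Local Open Scope ring_scope.

(* The number of symbols is N = n.+2, so that N >= 2 and the sequence spaces
   below are inhabited by construction.  The vertex i of Psi, seen in Omega, is
   [low i], and i^+ = i + N is [high i]. *)
Notation Psi n := 'I_n.+2.
Notation Omega n := 'I_(n.+2 + n.+2).

Definition low {n} (i : Psi n) : Omega n := lshift n.+2 i.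
Definition high {n} (i : Psi n) : Omega n := rshift n.+2 i.

(* The projection sending both i and i^+ to i. *)
Definition bar {n} (a : Omega n) : Psi n :=
  match fintype.split a with inl i => i | inr i => i end.

Record digraph n := Digraph {
  edge :> rel (Omega n);
  edge_out : forall a, exists b, edge a b }.

Definition Gword n (G : digraph n) k : {set k.-tuple (Omega n)} :=
  [set t : k.-tuple (Omega n) | sorted G t]%SET.

Definition Mset n (G : digraph n) (i j : Psi n) : {set 2.-tuple (Omega n)} :=
  ([set [tuple low i; low j]; [tuple low i; high j];
        [tuple high i; low j]; [tuple high i; high j]] :&: Gword G 2)%SET.

Definition lifts n k (s : k.-tuple (Psi n)) : {set k.-tuple (Omega n)} :=
  [set t : k.-tuple (Omega n) | [forall h,
    (tnth t h == low (tnth s h)) || (tnth t h == high (tnth s h))]]%SET.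

Definition Sword n (G : digraph n) k : {set k.-tuple (Psi n)} :=
  [set s : k.-tuple (Psi n) | (lifts s :&: Gword G k)%SET != finset.set0]%SET.

Definition Gamma n (G : digraph n) k (s : k.-tuple (Psi n)) :
  {set k.-tuple (Omega n)} := (Gword G k :&: lifts s)%SET.

Section Words.
Context {I : Type}.

Definition tlast m (s : m.+1.-tuple I) : I := tnth s ord_max.

Definition restr (x : nat -> I) m : m.+1.-tuple I := [tuple x h | h < m.+1].

Fixpoint Tword (V : Type) (T : I -> I -> V -> V) (s : seq I) : V -> V :=
  if s is a :: s' then
    if s' is b :: _ then T a b \o Tword T s' else id
  else id.

Definition Jword (V : Type) (T : I -> I -> V -> V) (J : I -> set V)
  m (s : m.+1.-tuple I) : set V := (Tword T s @` J (tlast s))%classic.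

Fixpoint pword (R : pzSemiRingType) (p : I -> I -> R) (s : seq I) : R :=
  if s is a :: s' then
    if s' is b :: _ then p a b * pword p s' else 1
  else 1.

End Words.

Definition cylmass (R : realType) k (chi : 'rV[R]_k) (P : 'M[R]_k)
  m (s : m.+1.-tuple 'I_k) : R := chi 0 (thead s) * pword P s.

Definition I1 (R : realType) n (G : digraph n) (chi : 'rV[R]_(n.+2 + n.+2))
    (P : 'M[R]_(n.+2 + n.+2)) m (s : m.+1.-tuple (Psi n)) : R :=
  \sum_(t in Gamma G s | tlast t == low (tlast s)) cylmass chi P t.
Definition I2 (R : realType) n (G : digraph n) (chi : 'rV[R]_(n.+2 + n.+2))
    (P : 'M[R]_(n.+2 + n.+2)) m (s : m.+1.-tuple (Psi n)) : R :=
  \sum_(t in Gamma G s | tlast t == high (tlast s)) cylmass chi P t.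

Definition probability_vector (R : realType) k (chi : 'rV[R]_k) : Prop :=
  (forall i, 0 <= chi 0 i) /\ \sum_i chi 0 i = 1.

Definition row_stochastic (R : realType) k (P : 'M[R]_k) : Prop :=
  (forall i j, 0 <= P i j) /\ (forall i, \sum_j P i j = 1).

(* Meaningful for entrywise nonnegative matrices. *)
Definition irreducible (R : realType) k (A : 'M[R]_k) : Prop :=
  forall i j, exists2 m, (0 < m)%N & 0 < (A ^+ m) i j.

(* The library norm on 'rV[R]_q is the sup norm; similarities are taken with
   respect to the Euclidean one. *)
Definition enorm (R : realType) q (x : 'rV[R]_q) : R :=
  Num.sqrt (\sum_i x 0 i ^+ 2).

Definition contractive_similarity (R : realType) q (s : R)
    (f : 'rV[R]_q -> 'rV[R]_q) : Prop :=
  0 < s < 1 /\ forall x y, enorm (f x - f y) = s * enorm (x - y).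

Local Open Scope classical_set_scope.

Definition borel (T : ptopologicalType) := g_sigma_algebraType (@open T).

Notation symseq A := (prod_topology (fun _ : nat => discrete_topology A)).

Definition Ginf_set n (G : digraph n) : set (symseq (Omega n)) :=
  [set x | forall h, G (x h) (x h.+1)].

Definition Sinf_set n (G : digraph n) : set (symseq (Psi n)) :=
  [set y | exists2 x, Ginf_set G x &
    forall h, x h = low (y h) \/ x h = high (y h)].

(* The topology on [set_type] is the one induced by the product topology. *)
Definition Ginf n (G : digraph n) : Type := set_type (Ginf_set G).
Definition Sinf n (G : digraph n) : Type := set_type (Sinf_set G).

HB.instance Definition _ n (G : digraph n) :=
  Topological.copy (Ginf G) (set_type (Ginf_set G)).
HB.instance Definition _ n (G : digraph n) :=
  Topological.copy (Sinf G) (set_type (Sinf_set G)).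

Definition Gseq n (G : digraph n) (x : Ginf G) : nat -> Omega n := val x.
Definition Sseq n (G : digraph n) (y : Sinf G) : nat -> Psi n := val y.

Section Inhabited.
Variables (n : nat) (G : digraph n).

Let next (a : Omega n) : Omega n := xchoose (edge_out G a).

Fact Ginf_inhabited : Ginf_set G (fun h => iter h next (low ord0)).
Proof. by move=> h; exact: xchooseP. Qed.

Fact Sinf_inhabited : Sinf_set G (fun h => bar (iter h next (low ord0))).
Proof.
exists (fun h => iter h next (low ord0)); first exact: Ginf_inhabited.
move=> h; rewrite /bar /low /high; case: splitP => j ej;
  [left|right]; exact: val_inj.
Qed.

HB.instance Definition _ :=
  isPointed.Build (Ginf G)
    (SigSub (mem_set Ginf_inhabited) : set_type (Ginf_set G)).
HB.instance Definition _ :=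
  isPointed.Build (Sinf G)
    (SigSub (mem_set Sinf_inhabited) : set_type (Sinf_set G)).

End Inhabited.

Section Coding.
Context {R : realType} {q n : nat} (G : digraph n).
Variables (T : Psi n -> Psi n -> 'rV[R]_q -> 'rV[R]_q)
          (J : Psi n -> set 'rV[R]_q).

(* The extension of T and J to Omega: T_{a,b} = T_{i,j} for (a,b) in M_{i,j},
   and J_{i^+} = J_i. *)
Definition TOmega (a b : Omega n) := T (bar a) (bar b).
Definition JOmega (a : Omega n) := J (bar a).

(* Under the hypotheses of the theorem these intersections are singletons, and
   [get] picks their unique point. *)
Definition codingG (x : borel (Ginf G)) : borel 'rV[R]_q :=
  get (\bigcap_k Jword TOmega JOmega (restr (Gseq x) k)).

Definition codingS (y : borel (Sinf G)) : borel 'rV[R]_q :=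
  get (\bigcap_k Jword T J (restr (Sseq y) k)).

Definition Gmarkov (chi : 'rV[R]_(n.+2 + n.+2)) (P : 'M[R]_(n.+2 + n.+2))
    (nu : probability (borel (Ginf G)) R) : Prop :=
  forall m (s : m.+1.-tuple (Omega n)), s \in Gword G m.+1 ->
    nu [set x | restr (Gseq x) m = s] = (cylmass chi P s)%:E.

Definition Smarkov (chi : 'rV[R]_n.+2) (P : 'M[R]_n.+2)
    (nu1 : probability (borel (Sinf G)) R) : Prop :=
  forall m (s : m.+1.-tuple (Psi n)),
    nu1 [set y | restr (Sseq y) m = s] = (cylmass chi P s)%:E.

Definition reducible (mu : set (borel 'rV[R]_q) -> \bar R) : Prop :=
  exists chi P nu1,
    [/\ probability_vector chi, row_stochastic P, Smarkov chi P nu1 &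
        forall A, measurable A -> mu A = pushforward nu1 codingS A].

End Coding.

(* Main.v *)
(* Write M(w) for the total mass of the lifts of a word w.  The cylinder sets
   J_w are Borel and are pulled back by the coding to the cylinders of the
   symbolic space, so mu is reducible iff M itself is the cylinder mass of a
   Markov chain on Psi (conversely, the image of nu under bar is the required
   Markov measure).  If w ends in i, then
     M(wj) = (p_ij + p_ij+) I_1(w) + (p_i+j + p_i+j+) I_2(w),
   and requiring that M(wj) / M(w) depend only on (i, j) amounts to
     (chi_i+ I_1(w) - chi_i I_2(w)) (p_ij + p_ij+ - p_i+j - p_i+j+) = 0,
   the case w = i giving the value of the quotient.  When P_4 = 0, condition (b)
   at i is impossible: it forces the return probabilities at i of the stochastic
   irreducible P_2 to be bounded by those of P_1, whose powers decay
   geometrically because every row of P_1 loses mass to P_3. *)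

Require Import Defs.
From mathcomp Require Import all_boot all_order all_algebra.
From mathcomp Require Import all_classical all_reals all_analysis.
From mathcomp Require Import ring.

Set Implicit Arguments.
Unset Strict Implicit.
Unset Printing Implicit Defensive.

Import Order.TTheory GRing.Theory Num.Theory.
Import numFieldNormedType.Exports.

Local Open Scope classical_set_scope.
Local Open Scope ring_scope.

(** * The projection from [Omega] to [Psi], its fibres, and words over them *)

Lemma bar_low n (i : Psi n) : bar (low i) = i.
Proof.
rewrite /bar /low; case: splitP => j /= ej; apply: val_inj => //=.
by move: (ltn_ord i); rewrite ej ltnNge leq_addr.
Qed.

Lemma bar_high n (i : Psi n) : bar (high i) = i.
Proof.
rewrite /bar /high; case: splitP => j /= ej; apply: val_inj => /=.
  by move: (ltn_ord j); rewrite -ej ltnNge leq_addr.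
by apply/eqP; rewrite -(eqn_add2l n.+2) ej.
Qed.

Lemma low_neq_high n (i j : Psi n) : (low i == high j) = false.
Proof.
apply/negP => /eqP /(congr1 val) /= e.
by move: (ltn_ord i); rewrite e ltnNge leq_addr.
Qed.

Lemma bar_eq n (a : Omega n) i : (bar a == i) = (a == low i) || (a == high i).
Proof.
apply/eqP/orP => [|[/eqP->|/eqP->]]; rewrite ?bar_low ?bar_high //.
by rewrite /bar -{2 3}(splitK a); case: fintype.split => j /= ->; [left|right].
Qed.

Lemma big_bar (R : nmodType) n (j : Psi n) (F : Omega n -> R) :
  \sum_(b | bar b == j) F b = F (low j) + F (high j).
Proof.
rewrite (bigD1 (low j)) ?bar_low //= (bigD1 (high j)) /=; last first.
  by rewrite bar_high eqxx eq_sym low_neq_high.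
rewrite big1 ?addr0 // => b; rewrite bar_eq.
by case: (b == low j); case: (b == high j).
Qed.

(** [Q] and [F] live on sequences rather than tuples, so peeling off the head needs no cast between
    tuple lengths. *)
Lemma big_cons_tuple (R : nmodType) (A : finType) m (Q : pred (seq A))
    (F : seq A -> R) :
  \sum_(t : m.+1.-tuple A | Q t) F t =
  \sum_a \sum_(t : m.-tuple A | Q (a :: t)) F (a :: t).
Proof.
rewrite pair_big_dep /=.
rewrite (reindex (fun p : A * m.-tuple A => cons_tuple p.1 p.2)) //=.
exists (fun t : m.+1.-tuple A => (thead t, [tuple of behead t])).
  by move=> [a t] _ /=; congr pair; apply: val_inj.
by move=> t _; rewrite [RHS]tuple_eta.
Qed.

Lemma pword_rcons (R : pzSemiRingType) (I : Type) (p : I -> I -> R) i s j :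
  pword p (rcons (i :: s) j) = pword p (i :: s) * p (last i s) j.
Proof.
elim: s i => [|k s IH] i; first by rewrite /= mulr1 mul1r.
by rewrite /= in IH *; rewrite IH mulrA.
Qed.

(** Replaces the coordinatewise condition by one equation of sequences, which [eqseq_cons] then
    splits letter by letter. *)
Lemma lifts_bar n k (s : k.-tuple (Psi n)) (t : k.-tuple (Omega n)) :
  (t \in lifts s) = (map bar t == s :> seq _).
Proof.
rewrite inE; apply/forallP/eqP => [H|H h].
  have -> : [seq bar i | i <- t] = val (map_tuple bar t) by [].
  congr val; apply: eq_from_tnth => h; rewrite tnth_map; apply/eqP.
  by rewrite bar_eq.
have -> : s = map_tuple bar t by exact: val_inj.
by rewrite tnth_map -bar_eq.
Qed.

Lemma tlast_last (I : Type) m (t : m.+1.-tuple I) x : tlast t = last x t.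
Proof. by rewrite /tlast (tnth_nth x) (last_nth x) size_tuple; case/tupleP: t. Qed.

(** * Weighted sums over the lifts of a word *)

Section Lifts.
Variables (R : realType) (n : nat) (G : digraph n).
Variables (chi : 'rV[R]_(n.+2 + n.+2)) (P : 'M[R]_(n.+2 + n.+2)).
Hypothesis P0 : forall a b, ~~ G a b -> P a b = 0.

(* [lift_sum h s a] is the sum of [p_t * h (last t)] over the lifts [t] of [s]
   preceded by [a]. *)
Fixpoint lift_sum (h : Omega n -> R) (s : seq (Psi n)) (a : Omega n) : R :=
  if s is j :: s' then
    P a (low j) * lift_sum h s' (low j) + P a (high j) * lift_sum h s' (high j)
  else h a.

(** [h] weighs the last vertex of a lift: the constant 1 yields [liftmass], and the indicators of
    the two vertices over the last letter yield [I1] and [I2]. *)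
Definition word_sum (h : Omega n -> R) (w : seq (Psi n)) : R :=
  if w is i :: s then
    chi 0 (low i) * lift_sum h s (low i) + chi 0 (high i) * lift_sum h s (high i)
  else 0.

Definition liftmass m (w : m.+1.-tuple (Psi n)) : R :=
  \sum_(t in Gamma G w) cylmass chi P t.

(** The transition operator restricted to targets over [j]: it turns a weight on the last vertex
    into a weight on its predecessor. *)
Definition step (h : Omega n -> R) j (a : Omega n) : R :=
  P a (low j) * h (low j) + P a (high j) * h (high j).

(** Because of this, sums over [Gamma G w] extend to all lifts of [w], which form a product and can
    be summed letter by letter. *)
Lemma pword_notin (s : seq (Omega n)) : ~~ sorted G s -> pword P s = 0.
Proof.
case: s => [|a s] //=; elim: s a => [|b s IH] a //=.
rewrite negb_and => /orP [/P0 ->|/IH e]; first by rewrite mul0r.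
by rewrite /= in e; rewrite e mulr0.
Qed.

Lemma sum_lifts h m (s : seq (Psi n)) a : size s = m ->
  \sum_(t : m.-tuple (Omega n) | map bar t == s) pword P (a :: t) * h (last a t)
  = lift_sum h s a.
Proof.
elim: m s a => [|m IH] [|j s] a //= => [_|[sz]].
  rewrite (big_pred1 [tuple]) /= ?mul1r // => t.
  by rewrite tuple0.
rewrite (big_cons_tuple _ (fun t => map bar t == j :: s)
          (fun t => pword P (a :: t) * h (last a t))) /=.
rewrite -(big_bar (R := R) j (fun b => P a b * lift_sum h s b)) [RHS]big_mkcond.
apply: eq_bigr => b _; under eq_bigl do rewrite eqseq_cons.
case: eqP => _ /=; last by rewrite big_pred0.
by rewrite -(IH s b sz) mulr_sumr; apply: eq_bigr => t _; rewrite mulrA.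
Qed.

Lemma sum_Gamma h m (w : m.+1.-tuple (Psi n)) :
  \sum_(t in Gamma G w) cylmass chi P t * h (tlast t) = word_sum h w.
Proof.
pose F (t : seq (Omega n)) :=
  (if t is a :: _ then chi 0 a * pword P t * h (last a t) else 0).
transitivity (\sum_(t : m.+1.-tuple (Omega n) | map bar t == w) F t).
  rewrite big_mkcond [RHS]big_mkcond; apply: eq_bigr => t _.
  rewrite inE lifts_bar inE; case: (_ == _ :> seq _); rewrite ?andbF ?andbT //.
  have -> : F t = cylmass chi P t * h (tlast t).
    by case/tupleP: t => a t; rewrite /F /cylmass /= theadE (tlast_last _ a).
  by case: ifP => // /negbT /pword_notin e; rewrite /cylmass e mulr0 mul0r.
rewrite (big_cons_tuple _ (fun t => map bar t == w) F) /=.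
case/tupleP: w => i s /=.
have sz : size s = m by rewrite size_tuple.
rewrite -(big_bar (R := R) i (fun b => chi 0 b * lift_sum h s b)) [RHS]big_mkcond.
apply: eq_bigr => b _; under eq_bigl do rewrite eqseq_cons.
case: eqP => _ /=; last by rewrite big_pred0.
by rewrite -(sum_lifts _ _ sz) mulr_sumr; apply: eq_bigr => t _; rewrite !mulrA.
Qed.

(** The recursion peels letters off the front, while the Markov property concerns the last one; a
    letter added at the end is absorbed into the terminal weight. *)
Lemma lift_sum_rcons h s j a : lift_sum h (rcons s j) a = lift_sum (step h j) s a.
Proof. by elim: s a => [|k s IH] a //=; rewrite !IH. Qed.

Lemma word_sum_rcons h w j : w != [::] -> word_sum h (rcons w j) = word_sum (step h j) w.
Proof. by case: w => [|i s] //= _; rewrite !lift_sum_rcons. Qed.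

(** Every lift ends at one of the two vertices over [l], so [h] enters only through its two values
    there, and linearly. *)
Lemma word_sum_lin h (w : seq (Psi n)) l : w != [::] -> last l w = l ->
  word_sum h w = h (low l) * word_sum (fun a => (a == low l)%:R) w +
            h (high l) * word_sum (fun a => (a == high l)%:R) w.
Proof.
case: w => [|i s] //= _.
have bl a : last (bar a) s = l -> lift_sum h s a =
    h (low l) * lift_sum (fun a => (a == low l)%:R) s a +
    h (high l) * lift_sum (fun a => (a == high l)%:R) s a.
  elim: s a => [|k s IH] a /=.
    move=> /eqP; rewrite bar_eq => /orP [/eqP->|/eqP->]; rewrite eqxx.
      by rewrite low_neq_high mulr1 mulr0 addr0.
    by rewrite (eq_sym (high l)) low_neq_high mulr1 mulr0 add0r.
  by move=> e; rewrite !IH ?bar_low ?bar_high //; ring.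
by move=> e; rewrite !bl ?bar_low ?bar_high //; ring.
Qed.

Lemma I1E m (w : m.+1.-tuple (Psi n)) :
  I1 G chi P w = word_sum (fun a => (a == low (tlast w))%:R) w.
Proof.
rewrite -sum_Gamma /I1 big_mkcondr; apply: eq_bigr => t _.
by case: ifP; rewrite ?mulr1 ?mulr0.
Qed.

Lemma I2E m (w : m.+1.-tuple (Psi n)) :
  I2 G chi P w = word_sum (fun a => (a == high (tlast w))%:R) w.
Proof.
rewrite -sum_Gamma /I2 big_mkcondr; apply: eq_bigr => t _.
by case: ifP; rewrite ?mulr1 ?mulr0.
Qed.

Lemma word_sum_I h m (w : m.+1.-tuple (Psi n)) :
  word_sum h w = h (low (tlast w)) * I1 G chi P w + h (high (tlast w)) * I2 G chi P w.
Proof.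
rewrite I1E I2E; apply: word_sum_lin; first by case/tupleP: w.
by rewrite -tlast_last.
Qed.

Lemma liftmassE m (w : m.+1.-tuple (Psi n)) : liftmass w = word_sum (fun=> 1) w.
Proof. by rewrite -sum_Gamma; apply: eq_bigr => t _; rewrite mulr1. Qed.

Lemma liftmass_I m (w : m.+1.-tuple (Psi n)) :
  liftmass w = I1 G chi P w + I2 G chi P w.
Proof. by rewrite liftmassE word_sum_I !mul1r. Qed.

Lemma liftmass_rcons m (w : m.+1.-tuple (Psi n)) j :
  liftmass [tuple of rcons w j] =
  (P (low (tlast w)) (low j) + P (low (tlast w)) (high j)) * I1 G chi P w +
  (P (high (tlast w)) (low j) + P (high (tlast w)) (high j)) * I2 G chi P w.
Proof.
rewrite liftmassE /= word_sum_rcons; last by case/tupleP: w.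
by rewrite word_sum_I /step !mulr1.
Qed.

Lemma liftmass1 i : liftmass [tuple i] = chi 0 (low i) + chi 0 (high i).
Proof. by rewrite liftmassE /= !mulr1. Qed.

Lemma I1_1 i : I1 G chi P [tuple i] = chi 0 (low i).
Proof.
rewrite I1E (tlast_last _ i) /= eqxx (eq_sym (high i)) low_neq_high.
by rewrite mulr1 mulr0 addr0.
Qed.

Lemma I2_1 i : I2 G chi P [tuple i] = chi 0 (high i).
Proof. by rewrite I2E (tlast_last _ i) /= eqxx low_neq_high mulr1 mulr0 add0r. Qed.

Lemma Gamma_notin m (w : m.-tuple (Psi n)) :
  w \notin Sword G m -> Gamma G w = finset.set0.
Proof. by rewrite inE negbK /Gamma finset.setIC => /eqP. Qed.

Lemma I1_notin m (w : m.+1.-tuple (Psi n)) :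
  w \notin Sword G m.+1 -> I1 G chi P w = 0.
Proof. by move=> /Gamma_notin e; rewrite /I1 e big1 // => t; rewrite inE. Qed.

Lemma I2_notin m (w : m.+1.-tuple (Psi n)) :
  w \notin Sword G m.+1 -> I2 G chi P w = 0.
Proof. by move=> /Gamma_notin e; rewrite /I2 e big1 // => t; rewrite inE. Qed.

End Lifts.

(** * When the lifted mass is the cylinder mass of a Markov chain *)

Lemma tuple_rcons_eta (I : Type) m (w : m.+2.-tuple I) :
  exists (v : m.+1.-tuple I) j, w = [tuple of rcons v j].
Proof.
case: w => -[|a w] sz //.
have sz' : size (belast a w) == m.+1 by rewrite size_belast.
by exists (Tuple sz'), (last a w); apply: val_inj; rewrite /= -lastI.
Qed.

Lemma cylmass_rcons (R : realType) k (chi : 'rV[R]_k) (P : 'M[R]_k)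
    m (w : m.+1.-tuple 'I_k) j :
  cylmass chi P [tuple of rcons w j] = cylmass chi P w * P (tlast w) j.
Proof.
rewrite /cylmass; case/tupleP: w => i s.
rewrite theadE (tlast_last _ i) -mulrA -pword_rcons /=.
by congr (chi 0 _ * _); rewrite /thead (tnth_nth i).
Qed.

Section Criterion.
Variables (R : realType) (n : nat) (G : digraph n).
Variables (chi : 'rV[R]_(n.+2 + n.+2)) (P : 'M[R]_(n.+2 + n.+2)).
Hypotheses (P0 : forall a b, ~~ G a b -> P a b = 0).
Hypotheses (chi_prob : probability_vector chi) (chi_gt0 : forall a, 0 < chi 0 a).
Hypothesis P_stochastic : row_stochastic P.

(** Reducibility expressed on words alone; [reducible_liftmass] connects it with the measures. *)
Definition mass_is_markov :=
  exists (chi' : 'rV[R]_n.+2) (P' : 'M[R]_n.+2),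
    [/\ probability_vector chi', row_stochastic P' &
        forall m (w : m.+1.-tuple (Psi n)), liftmass G chi P w = cylmass chi' P' w].

Local Notation a_ i j := (P (low i) (low j) + P (low i) (high j)).
Local Notation b_ i j := (P (high i) (low j) + P (high i) (high j)).

Definition sum_condition i := forall j, a_ i j = b_ i j.
Definition ratio_condition i := forall m (w : m.+1.-tuple (Psi n)),
  w \in Sword G m.+1 -> tlast w = i ->
  chi 0 (high i) * I1 G chi P w = chi 0 (low i) * I2 G chi P w.

Lemma markov_condition : mass_is_markov ->
  forall i, sum_condition i \/ ratio_condition i.
Proof.
move=> [chi' [P' [_ _ E]]] i.
have [|/existsNP [j /eqP ab]] := pselect (sum_condition i); [by left|right].
move=> m w _ wi.
(* For a [j] violating (a), appending [j] to [w] and to the one-letter word [i] multiplies the mass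
   by the same factor [P' i j]. *)
have := E _ [tuple of rcons w j].
have := E _ [tuple of rcons [tuple i] j].
rewrite !cylmass_rcons -!E !liftmass_rcons // !liftmass_I // I1_1 // I2_1 //.
rewrite wi [tlast [tuple i]](tlast_last _ i) /=.
move: (I1 G chi P w) (I2 G chi P w) => x y.
move: (chi_gt0 (low i)) (chi_gt0 (high i)) ab.
move: (chi 0 (low i)) (chi 0 (high i)) (a_ i j) (b_ i j) (P' i j) => c d a b p.
move=> c0 d0 ab e1 e2.
have ab' : a - b != 0 by rewrite subr_eq0.
apply/eqP; rewrite -subr_eq0 -(mulIr_eq0 _ (mulIf ab')).
apply/eqP.
(* By [e1] and [e2] both products on the right equal [(c + d) * (x + y) * p]. *)
have -> : (d * x - c * y) * (a - b) =
  (c + d) * (a * x + b * y) - (x + y) * (a * c + b * d) by ring.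
by rewrite e1 e2; ring.
Qed.

Lemma sum_Omega (F : Omega n -> R) :
  \sum_a F a = \sum_(i : Psi n) (F (low i) + F (high i)).
Proof. by rewrite big_split_ord /= big_split. Qed.

Lemma condition_markov :
  (forall i, sum_condition i \/ ratio_condition i) -> mass_is_markov.
Proof.
move=> H; have [Pge P1] := P_stochastic; have [cge c1] := chi_prob.
(* The witnesses are forced by words of length one and two: the mass of [i], and the mass of [ij]
   divided by that of [i]. *)
exists (\row_i (chi 0 (low i) + chi 0 (high i))).
exists (\matrix_(i, j) ((chi 0 (low i) * a_ i j + chi 0 (high i) * b_ i j) /
                       (chi 0 (low i) + chi 0 (high i)))).
have s0 i : chi 0 (low i) + chi 0 (high i) != 0.
  by rewrite gt_eqF // addr_gt0.
split.
- split=> [i|]; first by rewrite mxE addr_ge0.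
  by under eq_bigr do rewrite mxE; rewrite -sum_Omega.
- split=> [i j|i].
    by rewrite mxE divr_ge0 // ?addr_ge0 // mulr_ge0 // addr_ge0.
  under eq_bigr do rewrite mxE; rewrite -mulr_suml big_split /= -!mulr_sumr.
  by rewrite -!(sum_Omega (P _)) !P1 !mulr1 divff.
elim=> [|m IH] w.
  have -> : w = [tuple thead w].
    by case/tupleP: w => i w; apply: val_inj; rewrite (tuple0 w).
  by rewrite liftmass1 // /cylmass mxE mulr1.
have [v [j ->]] := tuple_rcons_eta w.
rewrite cylmass_rcons -IH liftmass_rcons // liftmass_I // mxE.
set i := tlast v.
(* Under (a) the quotient is [a_ i j] itself, however the mass of [v] is split between its two end
   vertices. *)
case: (H i) => [/(_ j) <-|]; first by move: (s0 i) => ?; field.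
(* Condition (b) covers only words of [Sword]; for the others both parts of the mass vanish. *)
have [vS|vS] := boolP (v \in Sword G m.+1); last first.
  by rewrite I1_notin // I2_notin // !mulr0 !addr0 mul0r.
move=> /(_ _ v vS erefl); rewrite -/i.
move: (s0 i); move: (I1 G chi P v) (I2 G chi P v) => x y.
move: (chi 0 (low i)) (chi 0 (high i)) (a_ i j) (b_ i j) => c d a b cd e.
apply: (mulIf cd); rewrite mulrA divfK //.
apply/eqP; rewrite -subr_eq0; apply/eqP.
transitivity ((d * x - c * y) * (a - b)); first by ring.
by rewrite e subrr mul0r.
Qed.

End Criterion.

(** * Powers of nonnegative matrices *)

Section SubMarkov.
Variables (R : realType) (k : nat).
Implicit Types (A B : 'M[R]_k.+1).

Lemma exprmx_ge0 A : (forall i j, 0 <= A i j) -> forall m i j, 0 <= (A ^+ m) i j.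
Proof.
move=> A0; elim=> [|m IH] i j; first by rewrite expr0 mxE ler0n.
by rewrite exprS mxE sumr_ge0 // => l _; rewrite mulr_ge0.
Qed.

Lemma exprmx_row_sum A : row_stochastic A ->
  forall m i, \sum_j (A ^+ m) i j = 1.
Proof.
move=> [_ A1]; elim=> [|m IH] i.
  rewrite (bigD1 i) //= expr0 mxE eqxx big1 ?addr0 // => j /negbTE ji.
  by rewrite mxE eq_sym ji.
rewrite exprS; under eq_bigr do rewrite mxE.
rewrite exchange_big /= -[RHS](A1 i); apply: eq_bigr => l _.
by rewrite -mulr_sumr IH mulr1.
Qed.

Lemma exprmx_le A r : (forall i j, 0 <= A i j) -> 0 <= r ->
  (forall i, \sum_j A i j <= r) -> forall m i j, (A ^+ m) i j <= r ^+ m.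
Proof.
move=> A0 r0 Ar; elim=> [|m IH] i j; first by rewrite !expr0 mxE lern1 leq_b1.
rewrite !exprS mxE; apply: le_trans (_ : \sum_l A i l * r ^+ m <= _).
  by apply: ler_sum => l _; rewrite ler_wpM2l.
by rewrite -mulr_suml ler_wpM2r // exprn_ge0.
Qed.

(** An entry of a power is a sum of path weights, so a pathwise comparison adds up. [x] and [y] vary
    in the induction because they collect the weights of the steps already taken. *)
Lemma exprmx_le_loops A B i : (forall i j, 0 <= A i j) -> (forall i j, 0 <= B i j) ->
  forall m j x y, 0 <= x -> 0 <= y ->
  (forall s, size s = m -> last j s = i ->
     x * pword B (j :: s) <= y * pword A (j :: s)) ->
  x * (B ^+ m) j i <= y * (A ^+ m) j i.
Proof.
move=> A0 B0; elim=> [|m IH] j x y x0 y0 H.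
  rewrite !expr0 !mxE; have [e|_] := eqVneq j i; last by rewrite !mulr0.
  by have := H [::] erefl e.
rewrite !exprS !mxE !mulr_sumr; apply: ler_sum => l _; rewrite !mulrA.
apply: IH; rewrite ?mulr_ge0 // => s sm sl.
by rewrite -!mulrA; apply: (H (l :: s)); rewrite //= sm.
Qed.

(* The mass [\sum_j (B ^+ m) i j = 1] leads back to [i] in boundedly many
   steps, which is incompatible with a geometric decay of the return
   probabilities. *)
Lemma irreducible_return_not_geometric B i r : row_stochastic B ->
  irreducible B -> 0 <= r < 1 -> ~ (forall m, (B ^+ m) i i <= r ^+ m).
Proof.
move=> SB IB /andP[r0 r1] H; have B0 := exprmx_ge0 SB.1.
have /choice [t tP] : forall j, exists m, 0 < (B ^+ m) j i.
  by move=> j; have [m _ ?] := IB j i; exists m.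
(* Going from [i] to [j] in [m] steps and back in [t j] steps is a return, so the product of the two
   probabilities is at most [r ^+ (m + t j)], hence at most [r ^+ m]. Dividing by the return factor
   and summing over [j] produces [C]. *)
pose C := \sum_j ((B ^+ t j) j i)^-1.
have bound m : 1 <= C * r ^+ m.
  rewrite -(exprmx_row_sum SB m i) mulr_suml; apply: ler_sum => j _.
  rewrite ler_pdivlMl // mulrC; apply: le_trans (_ : r ^+ (m + t j) <= _).
    apply: le_trans (H _); rewrite exprD mxE (bigD1 j) //= lerDl.
    by apply: sumr_ge0 => l _; rewrite mulr_ge0.
  by rewrite exprD ler_piMr ?exprn_ge0 // exprn_ile1 // ltW.
have : (fun m => C * r ^+ m) @ \oo --> (C * 0 : R).
  by apply: cvgMr; apply: cvg_expr; rewrite ger0_norm.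
rewrite mulr0 => /cvgrPdist_lt /(_ 1 ltr01) [m _ /(_ m (leqnn m))] /=.
rewrite sub0r normrN => /(le_lt_trans (ler_norm _)).
by rewrite ltNge bound.
Qed.

End SubMarkov.

(** * The block-triangular case: excluding condition (b) *)

Section Triangular.
Variables (R : realType) (n : nat) (G : digraph n).
Variables (chi : 'rV[R]_(n.+2 + n.+2)) (P : 'M[R]_(n.+2 + n.+2)).
Hypotheses (P0 : forall a b, ~~ G a b -> P a b = 0).
Hypothesis chi_gt0 : forall a, 0 < chi 0 a.
Hypothesis P_stochastic : row_stochastic P.

Let Pge a b : 0 <= P a b. Proof. exact: P_stochastic.1. Qed.

Lemma lift_sum_ge0 (h : Omega n -> R) : (forall a, 0 <= h a) ->
  forall s a, 0 <= lift_sum P h s a.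
Proof.
by move=> h0; elim=> [|j s IH] a //=; rewrite addr_ge0 // mulr_ge0.
Qed.

(** One of the lifts counted stays in the upper copy throughout, and the others contribute
    nonnegative amounts. *)
Lemma lift_sum_high_ge i s j : last j s = i ->
  pword (drsubmx P) (j :: s) <= lift_sum P (fun a => (a == high i)%:R) s (high j).
Proof.
elim: s j => [|l s IH] j /=; first by move=> ->; rewrite eqxx.
move=> /IH {}IH; rewrite !mxE.
apply: le_trans (_ : P (high j) (high l) *
    lift_sum P (fun a => (a == high i)%:R) s (high l) <= _).
  by rewrite ler_wpM2l.
by rewrite lerDr mulr_ge0 // lift_sum_ge0.
Qed.

Hypothesis P4 : dlsubmx P = 0.

Lemma P_high_low i j : P (high i) (low j) = 0.
Proof. by have := congr1 (fun A : 'M[R]_(n.+2) => A i j) P4; rewrite !mxE. Qed.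

Lemma lift_sum_low_high i s j : lift_sum P (fun a => (a == low i)%:R) s (high j) = 0.
Proof.
elim: s j => [|l s IH] j /=; first by rewrite eq_sym low_neq_high.
by rewrite P_high_low IH mul0r mulr0 addr0.
Qed.

(** The upper copy cannot be left, so a lift ending in the lower copy has stayed there: a single
    path remains. *)
Lemma lift_sum_low_low i s j : last j s = i ->
  lift_sum P (fun a => (a == low i)%:R) s (low j) = pword (ulsubmx P) (j :: s).
Proof.
elim: s j => [|l s IH] j /=; first by move=> ->; rewrite eqxx.
by move=> /IH {}IH; rewrite lift_sum_low_high mulr0 addr0 !mxE; congr (_ * _).
Qed.

Lemma not_ratio_condition i : irreducible (drsubmx P) ->
  (forall i, exists j, 0 < P (low i) (high j)) -> ~ ratio_condition G chi P i.
Proof.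
move=> irr leak ratio.
have A0 j l : 0 <= ulsubmx P j l by rewrite !mxE.
have B0 j l : 0 <= drsubmx P j l by rewrite !mxE.
have SB : row_stochastic (drsubmx P).
  split=> // j; rewrite -(P_stochastic.2 (high j)) sum_Omega.
  by apply: eq_bigr => l _; rewrite P_high_low add0r !mxE.
(* The largest row sum of the lower block, made nonnegative by the initial value 0; [leak] puts
   every row sum below 1. *)
pose r := \big[Num.max/0]_j \sum_l ulsubmx P j l.
have r01 : 0 <= r < 1.
  apply/andP; split; first exact: bigmax_ge_id.
  apply: bigmax_lt => // j _; rewrite -(P_stochastic.2 (low j)) sum_Omega.
  rewrite big_split /=; under eq_bigr do rewrite !mxE.
  rewrite ltrDl; have [l Pl] := leak j.
  by rewrite (bigD1 l) //= ltr_pwDl // sumr_ge0.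
apply: (irreducible_return_not_geometric SB irr r01 (i := i)) => m.
apply: le_trans (_ : (ulsubmx P ^+ m) i i <= _); last first.
  apply: exprmx_le => //; first by case/andP: r01.
  by move=> j; exact: le_bigmax.
(* For a loop [w] at [i], [I1] is [chi 0 (low i)] times its weight in [ulsubmx P], and [I2] is at
   least [chi 0 (high i)] times its weight in [drsubmx P]. Condition (b) thus compares the two
   weights multiplied by [x]. *)
pose x := chi 0 (low i) * chi 0 (high i).
have x0 : 0 < x by rewrite mulr_gt0.
rewrite -(ler_pM2l x0); apply: exprmx_le_loops => //; rewrite ?(ltW x0) // => s sm sl.
pose w : m.+1.-tuple (Psi n) := cons_tuple i (tcast sm (in_tuple s)).
have we : w = i :: s :> seq _ by rewrite /= val_tcast.
have wi : tlast w = i by rewrite (tlast_last _ i) we.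
have ratio_w : chi 0 (high i) * I1 G chi P w = chi 0 (low i) * I2 G chi P w.
  have [wS|wS] := boolP (w \in Sword G m.+1); first exact: ratio.
  by rewrite I1_notin // I2_notin // !mulr0.
move: ratio_w; rewrite I1E // I2E // wi we /= lift_sum_low_high lift_sum_low_low // mulr0 addr0.
rewrite mulrA => e.
rewrite {2}/x (mulrC (chi 0 (low i))) e.
rewrite /x -mulrA ler_wpM2l ?(ltW (chi_gt0 _)) //.
apply: le_trans (_ : chi 0 (high i) *
    lift_sum P (fun a => (a == high i)%:R) s (high i) <= _).
  by rewrite ler_wpM2l ?(ltW (chi_gt0 _)) // lift_sum_high_ge.
by rewrite lerDr mulr_ge0 ?(ltW (chi_gt0 _)) // lift_sum_ge0.
Qed.

End Triangular.

(** * Topology and Borel sets of the sequence spaces *)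

Lemma sequence_cylinder_open (A : choiceType) (X : set (symseq A)) h (a : A) :
  open [set x : set_type X | (val x : nat -> A) h = a].
Proof.
have -> : [set x : set_type X | (val x : nat -> A) h = a] =
    set_val @^-1` (proj h @^-1` [set a] : set (symseq A)) by [].
apply: open_comp; first by move=> x _; exact: initial_continuous.
apply: open_comp; first by move=> x _; exact: proj_continuous.
exact: discrete_open.
Qed.

(** The topology is induced from a product of discrete spaces, so it suffices to test single
    coordinates at single values. *)
Lemma continuous_sequence (Y : topologicalType) (A : choiceType)
    (X : set (symseq A)) (f : Y -> set_type X) :
  (forall h a, open [set y | (val (f y) : nat -> A) h = a]) -> continuous f.
Proof.
move=> fo; apply: continuous_comp_initial => y.
apply/cvg_sup => h U [V] [[W] oW <-] Wy WU; apply: (filterS WU).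
have := fo h ((val (f y) : nat -> A) h); rewrite openE => /(_ y erefl).
apply: filterS => z e; change (W ((val (f z) : nat -> A) h)).
have {}e : (val (f z) : nat -> A) h = (val (f y) : nat -> A) h := e.
by rewrite e.
Qed.

Lemma open_borel (X : ptopologicalType) (A : set X) : open A ->
  measurable (A : set (borel X)).
Proof. exact: sub_sigma_algebra. Qed.

Lemma closed_borel (X : ptopologicalType) (A : set X) : closed A ->
  measurable (A : set (borel X)).
Proof.
move=> cA; rewrite -[A]setCK; apply: measurableC; apply: open_borel.
exact: closed_openC.
Qed.

Lemma continuous_borel (X Y : ptopologicalType) (f : X -> Y) : continuous f ->
  measurable_fun setT (f : borel X -> borel Y).
Proof.
move=> /continuousP cf; apply: (@measurability _ _ (borel X) (borel Y) setT f (@open Y)) => //.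
move=> _ [B oB <-].
by rewrite setTI; apply: open_borel; exact: cf.
Qed.

(** * Euclidean similarities in the sup-norm topology *)

Section EuclideanNorm.
Variables (R : realType) (q : nat).
Implicit Types x y : 'rV[R]_q.

Lemma norm_le_enorm x : `|x| <= enorm x.
Proof.
rewrite [leLHS]/Num.norm /= mx_normrE; apply: bigmax_le => [|[i j] _ /=].
  exact: sqrtr_ge0.
rewrite -sqrtr_sqr ler_wsqrtr // (ord1 i) (bigD1 j) //= lerDl sumr_ge0 // => k _.
exact: sqr_ge0.
Qed.

Lemma enorm_le_norm x : enorm x <= Num.sqrt q%:R * `|x|.
Proof.
rewrite -[X in _ * X](ger0_norm (normr_ge0 x)) -sqrtr_sqr -sqrtrM // ler_wsqrtr //.
rewrite mulr_natl -[X in _ *+ X]card_ord -sumr_const; apply: ler_sum => j _.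
rewrite -[_ ^+ 2]ger0_norm ?sqr_ge0 // normrX lerXn2r ?nnegrE //.
rewrite [leRHS]/Num.norm /= mx_normrE.
exact: (le_bigmax _ (fun ij : 'I_1 * 'I_q => `|x ij.1 ij.2|) (0, j)).
Qed.

Variables (s : R) (f : 'rV[R]_q -> 'rV[R]_q).
Hypothesis fs : contractive_similarity s f.

Lemma similarity_inj : injective f.
Proof.
move=> x y e; have [/andP[s0 _] /(_ x y)] := fs.
rewrite e subrr => E; apply/eqP; rewrite -subr_eq0 -normr_le0.
apply: le_trans (norm_le_enorm _) _; rewrite -(pmulr_rle0 _ s0) -E.
by rewrite /enorm big1 ?sqrtr0 // => i _; rewrite mxE expr0n.
Qed.

Lemma similarity_continuous : continuous f.
Proof.
(* [c] is the cost of passing from the sup norm to the Euclidean one; adding 1 keeps it positive for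
   every [q]. *)
have [/andP[s0 s1] E] := fs; pose c := Num.sqrt q%:R + 1 : R.
have c0 : 0 < c by rewrite ltr_wpDl.
move=> x; apply/(@cvgrPdist_le _ _ _ (nbhs x) (nbhs_filter x)) => e e0.
have ec0 : 0 < e / c by rewrite divr_gt0.
apply: filterS (nbhsx_ballx x _ ec0) => y; rewrite -ball_normE /= => /ltW xy.
apply: le_trans (norm_le_enorm _) _; rewrite E.
apply: le_trans (_ : enorm (x - y) <= _).
  by rewrite ler_piMl ?sqrtr_ge0 // ltW.
apply: le_trans (enorm_le_norm _) _.
apply: le_trans (_ : c * `|x - y| <= _); first by rewrite ler_wpM2r // lerDl.
by rewrite mulrC -ler_pdivlMr.
Qed.

End EuclideanNorm.

(** * The coding maps and the transfer of reducibility to words *)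

Section Coding.
Variables (R : realType) (q n : nat) (G : digraph n) (J : Psi n -> set 'rV[R]_q).
Variables (s : Psi n -> Psi n -> R) (T : Psi n -> Psi n -> 'rV[R]_q -> 'rV[R]_q).

Definition admissible : rel (Psi n) := fun i j => [tuple i; j] \in Sword G 2.

Lemma edge_admissible a b : G a b -> admissible (bar a) (bar b).
Proof.
move=> ab; rewrite /admissible inE; apply/set0Pn; exists [tuple a; b].
by rewrite inE lifts_bar inE /= ab eqxx.
Qed.

Lemma SwordP m (w : m.-tuple (Psi n)) :
  reflect (exists2 t : m.-tuple (Omega n), sorted G t & map bar t = w)
          (w \in Sword G m).
Proof.
rewrite inE; apply: (iffP (set0Pn _)) => [[t]|[t Gt tw]].
  by rewrite inE lifts_bar inE => /andP[/eqP ? ?]; exists t.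
by exists t; rewrite inE lifts_bar inE Gt tw eqxx.
Qed.

(** Only this direction holds in general: the edges lifting consecutive pairs need not fit together
    into one path of [G]. *)
Lemma Sword_sorted m (w : m.-tuple (Psi n)) : w \in Sword G m -> sorted admissible w.
Proof.
move=> /SwordP[t Gt <-]; rewrite sorted_map; apply: sub_sorted Gt.
exact: edge_admissible.
Qed.

Hypothesis J_nonempty : forall i, J i !=set0.
Hypothesis J_compact : forall i, compact (J i).
Hypothesis J_disjoint : trivIset setT J.
Hypothesis T_similarity :
  forall i j, admissible i j -> contractive_similarity (s i j) (T i j).
Hypothesis T_subset : forall i,
  \bigcup_(j in [set j | admissible i j]) (T i j @` J j) `<=` J i.
Hypothesis T_disjoint : trivIset [set ij | admissible ij.1 ij.2]
  (fun ij : Psi n * Psi n => T ij.1 ij.2 @` J ij.2).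

(** [J_w] with the head kept apart from the tail, so that inductions strip the outermost map and the
    word is never empty. *)
Definition Jpath i (w : seq (Psi n)) : set 'rV[R]_q :=
  Tword T (i :: w) @` J (last i w).

Lemma Jpath_nil i : Jpath i [::] = J i.
Proof. exact: image_id. Qed.

Lemma Jpath_cons i j w : Jpath i (j :: w) = T i j @` Jpath j w.
Proof. by rewrite /Jpath /= image_comp. Qed.

Lemma Jpath_sub i w : path admissible i w -> Jpath i w `<=` J i.
Proof.
elim: w i => [|j w IH] i /=; first by rewrite Jpath_nil => _; exact: subset_refl.
case/andP=> ij jw; rewrite Jpath_cons => x [u Ju <-].
by apply: T_subset; exists j => //; exists u => //; exact: IH Ju.
Qed.

Lemma Jpath_rcons_sub i w j : path admissible i (rcons w j) ->
  Jpath i (rcons w j) `<=` Jpath i w.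
Proof.
elim: w i => [|k w IH] i /=.
  by rewrite Jpath_nil => ij; apply: Jpath_sub.
by case/andP=> _ kw; rewrite !Jpath_cons; apply: image_subset; exact: IH.
Qed.

Lemma Jpath_nonempty i w : Jpath i w !=set0.
Proof.
by have [x Jx] := J_nonempty (last i w); exists (Tword T (i :: w) x); exists x.
Qed.

Lemma Jpath_compact i w : path admissible i w -> compact (Jpath i w).
Proof.
elim: w i => [|j w IH] i /=; first by rewrite Jpath_nil.
case/andP=> ij jw; rewrite Jpath_cons; apply: continuous_compact (IH _ jw).
by apply: continuous_subspaceT; exact: similarity_continuous (T_similarity ij).
Qed.

Lemma Jpath_closed i w : path admissible i w -> closed (Jpath i w).
Proof.
move=> iw; apply: compact_closed; last exact: Jpath_compact.
exact: (@norm_hausdorff R 'rV[R]_q).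
Qed.

(** Disjointness of the first-level images identifies the first two letters; injectivity of the
    outermost map then passes the common point on to the tails. *)
Lemma Jpath_disjoint i w i' w' x : path admissible i w -> path admissible i' w' ->
  size w = size w' -> Jpath i w x -> Jpath i' w' x -> i :: w = i' :: w'.
Proof.
elim: w i i' w' x => [|j w IH] i i' [|j' w'] x //=.
  rewrite !Jpath_nil => _ _ _ Jx J'x.
  by rewrite (J_disjoint (i := i) (j := i')) //; exists x.
case/andP=> ij jw /andP[ij' jw'] [sz]; rewrite !Jpath_cons.
move=> [u Ju ux] [u' Ju' ux'].
have [ei ej] : (i, j) = (i', j').
  apply: T_disjoint => //; exists x; split; first by exists u => //; exact: Jpath_sub Ju.
  by exists u' => //; exact: Jpath_sub Ju'.
rewrite -ei -ej in ux' ij' jw' Ju' *.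
have uu : u = u' by apply: (similarity_inj (T_similarity ij)); rewrite ux ux'.
by rewrite -uu in Ju'; congr cons; exact: IH Ju'.
Qed.

Lemma restrE (I : Type) (x : nat -> I) m : restr x m = mkseq x m.+1 :> seq I.
Proof. by rewrite /= /mkseq -val_enum_ord -map_comp. Qed.

Lemma restr_cons (I : Type) (x : nat -> I) m :
  restr x m = x 0%N :: mkseq (x \o S) m :> seq I.
Proof. by rewrite restrE /mkseq /= -[1%N]addn0 iotaDl -map_comp. Qed.

Lemma Jword_restr (x : nat -> Psi n) m :
  Jword T J (restr x m) = Jpath (x 0%N) (mkseq (x \o S) m).
Proof. by rewrite /Jword (tlast_last _ (x 0%N)) restr_cons. Qed.

Lemma Jword_path m (w : m.+1.-tuple (Psi n)) i v : w = i :: v :> seq _ ->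
  Jword T J w = Jpath i v.
Proof. by move=> e; rewrite /Jword (tlast_last _ i) e. Qed.

Lemma Sseq_path (y : Sinf G) m : path admissible (Sseq y 0) (mkseq (Sseq y \o S) m).
Proof.
apply/(pathP (Sseq y 0)) => h; rewrite size_mkseq => hm.
have -> : nth (Sseq y 0) (Sseq y 0 :: mkseq (Sseq y \o S) m) h = Sseq y h.
  by case: h hm => [|h] hm //=; rewrite nth_mkseq // ltnW.
rewrite nth_mkseq //=; have [x Gx xy] := set_mem (valP y).
have bx k : bar (x k) = Sseq y k.
  by apply/eqP; rewrite bar_eq; case: (xy k) => ->; rewrite eqxx ?orbT.
by rewrite -!bx; apply: edge_admissible; exact: Gx.
Qed.

(** The sets are nested, nonempty and compact, so their intersection has a point and [get] returns a
    member of it. *)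
Lemma codingS_in (y : Sinf G) k : Jword T J (restr (Sseq y) k) (codingS T J y).
Proof.
pose F k := Jword T J (restr (Sseq y) k).
have FE m : F m = Jpath (Sseq y 0) (mkseq (Sseq y \o S) m) by rewrite /F Jword_restr.
have Fsub m l : (m <= l)%N -> F l `<=` F m.
  elim: l => [|l IH]; first by rewrite leqn0 => /eqP ->.
  rewrite leq_eqVlt => /predU1P[->//|ml]; apply: subset_trans (IH ml).
  rewrite !FE mkseqS; apply: Jpath_rcons_sub; rewrite -mkseqS; exact: Sseq_path.
suff : \bigcap_k F k !=set0.
  by move=> /getPex /(_ k I).
have := @J_compact (Sseq y 0); rewrite compact_In0; apply.
  exists F => [m _|m _]; first by rewrite FE; apply/Jpath_closed/Sseq_path.
  rewrite setIidr // FE; exact/Jpath_sub/Sseq_path.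
(* Since the sets decrease, the deepest one of a finite subfamily lies in all the others. *)
move=> D _; have [x Fx] : F (\max_(i <- finmap.enum_fset D) i)%N !=set0.
  by rewrite FE; exact: Jpath_nonempty.
by exists x => m mD; apply: Fsub Fx; exact: leq_bigmax_seq.
Qed.

(** The sets [J_w] of one length are disjoint, so lying in one of them determines the initial
    letters of the code. *)
Lemma codingS_preimage m (w : m.+1.-tuple (Psi n)) : w \in Sword G m.+1 ->
  codingS T J @^-1` Jword T J w = [set y : Sinf G | restr (Sseq y) m = w].
Proof.
move=> /Sword_sorted wS; apply/seteqP; split => y /=; last first.
  by move=> <-; exact: codingS_in.
have := codingS_in y m; rewrite Jword_restr.
case/tupleP: w wS => i v /= wS yJ; rewrite (Jword_path (i := i) (v := v)) // => Jy.
apply: val_inj; apply: etrans (restr_cons (Sseq y) m) _.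
apply: Jpath_disjoint yJ Jy => //; first exact: Sseq_path.
by rewrite size_mkseq size_tuple.
Qed.

Lemma Jword_measurable m (w : m.+1.-tuple (Psi n)) : w \in Sword G m.+1 ->
  measurable (Jword T J w : set (borel 'rV[R]_q)).
Proof.
move=> /Sword_sorted; case/tupleP: w => i v wS.
by apply: closed_borel; rewrite (Jword_path (i := i) (v := v)) //; exact: Jpath_closed.
Qed.

Lemma bar_Ginf (x : Ginf G) : Sinf_set G (bar \o Gseq x).
Proof.
exists (Gseq x); first exact: set_mem (valP x).
move=> h; have := eqxx (bar (Gseq x h)).
by rewrite bar_eq => /orP[/eqP|/eqP]; [left|right].
Qed.

Definition barG (x : Ginf G) : Sinf G := SigSub (mem_set (bar_Ginf x)).

Lemma SseqE x : Sseq (barG x) = bar \o Gseq x. Proof. by []. Qed.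

Lemma barG_measurable : measurable_fun setT (barG : borel (Ginf G) -> borel (Sinf G)).
Proof.
apply: continuous_borel; apply: continuous_sequence => h i.
have -> : [set x : Ginf G | (val (barG x) : nat -> Psi n) h = i] =
   [set x | Gseq x h = low i] `|` [set x | Gseq x h = high i].
  apply/seteqP; split=> x /=; last first.
    by case=> e; rewrite /Gseq /= in e *; rewrite e ?bar_low ?bar_high.
  by move=> /eqP; rewrite bar_eq => /orP[/eqP|/eqP]; [left|right].
by apply: openU; exact: sequence_cylinder_open.
Qed.

(** [TOmega] and [JOmega] factor through [bar], so both sides apply [get] to the same set. *)
Lemma codingG_barG x : codingG T J x = codingS T J (barG x).
Proof.
rewrite /codingG /codingS; congr (get _); apply: eq_bigcapr => k _.
rewrite /Jword SseqE.
rewrite (tlast_last _ (Gseq x 0)) (tlast_last _ (bar (Gseq x 0))) !restrE.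
have -> : mkseq (bar \o Gseq x) k.+1 = map bar (mkseq (Gseq x) k.+1).
  by rewrite /mkseq -map_comp.
rewrite last_map /JOmega; congr (_ @` _).
elim: (mkseq _ _) => [|a [|b l] IH] //.
exact: (congr1 (fun g => T (bar a) (bar b) \o g) IH).
Qed.

Variables (chi : 'rV[R]_(n.+2 + n.+2)) (P : 'M[R]_(n.+2 + n.+2)).
Variable nu : probability (borel (Ginf G)) R.
Hypothesis nu_markov : Gmarkov chi P nu.

Lemma restr_Gword (x : Ginf G) m : restr (Gseq x) m \in Gword G m.+1.
Proof.
rewrite inE restrE; apply/(sortedP (Gseq x 0)) => h; rewrite size_mkseq => hm.
by rewrite !nth_mkseq // 1?ltnW //; exact: set_mem (valP x) h.
Qed.

Lemma nu_bar_cylinder m (w : m.+1.-tuple (Psi n)) :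
  nu [set x | restr (Sseq (barG x)) m = w] = (liftmass G chi P w)%:E.
Proof.
pose F (t : m.+1.-tuple (Omega n)) : set (borel (Ginf G)) :=
  [set x | restr (Gseq x) m = t].
(* The projected cylinder is the finite disjoint union of the cylinders of the lifts in
   [Gamma G w]. *)
have -> : [set x | restr (Sseq (barG x)) m = w] =
    \bigcup_(t in [set` enum (Gamma G w)]) F t.
  have E x : restr (Sseq (barG x)) m = map_tuple bar (restr (Gseq x) m).
    by apply: eq_from_tnth => h; rewrite !tnth_map.
  apply/seteqP; split=> x /=.
    move=> xw; exists (restr (Gseq x) m) => //=.
    by rewrite mem_enum inE restr_Gword lifts_bar -xw E eqxx.
  move=> [t /=]; rewrite mem_enum inE lifts_bar => /andP[_ /eqP tw] xt.
  by apply: val_inj; apply: etrans tw; rewrite E -xt.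
rewrite measure_fin_bigcup.
- rewrite -fsbig_seq ?enum_uniq //= big_enum /= /liftmass -sumEFin.
  apply: eq_bigr => t tG; apply: nu_markov.
  by move: tG; rewrite inE => /andP[].
- exact: finite_seq.
- by move=> t t' _ _ [x [<- <-]].
- move=> t _.
  have -> : F t = \bigcap_(h in [set: 'I_m.+1]) [set x | Gseq x h = tnth t h].
    apply/seteqP; split=> x /=; first by move=> <- h _; rewrite /= tnth_mktuple.
    by move=> H; apply: eq_from_tnth => h; rewrite tnth_mktuple; exact: H.
  apply: fin_bigcap_measurable => // h _.
  by apply: open_borel; exact: sequence_cylinder_open.
Qed.

Lemma reducible_liftmass :
  reducible G T J (pushforward nu (codingG T J)) <-> mass_is_markov G chi P.
Proof.
split=> [[chi' [P' [nu1 [c' sP' nu1_markov E]]]]|[chi' [P' [c' sP' E]]]].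
  exists chi', P'; split=> // m w; have [wS|wS] := boolP (w \in Sword G m.+1).
    have := E _ (Jword_measurable wS); rewrite /pushforward.
    rewrite (codingS_preimage wS) nu1_markov => e; apply: EFin_inj.
    rewrite -e -nu_bar_cylinder; congr (nu _).
    have -> : [set x : Ginf G | restr (Sseq (barG x)) m = w] =
        barG @^-1` [set y | restr (Sseq y) m = w] by [].
    rewrite -(codingS_preimage wS); apply/funext => x.
    by rewrite /preimage /= codingG_barG.
  (* Outside [Sword] both masses are zero: [Gamma G w] is empty, and so is the cylinder of [w] in
     [Sinf G]. *)
  apply: EFin_inj; rewrite -nu1_markov /liftmass Gamma_notin // big_set0.
  suff -> : [set y : Sinf G | restr (Sseq y) m = w] = set0 by rewrite measure0.
  rewrite -subset0 => y /= yw; move/negP: wS; apply.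
  have [x Gx xy] := set_mem (valP y).
  apply/SwordP; exists (restr x m).
    rewrite restrE; apply/(sortedP (x 0%N)) => h; rewrite size_mkseq => hm.
    by rewrite !nth_mkseq // 1?ltnW.
  rewrite -yw !restrE /mkseq -map_comp; apply: eq_map => h /=.
  by apply/eqP; rewrite bar_eq; case: (xy h) => ->; rewrite eqxx ?orbT.
(* The image of [nu] under [barG] has the lifted masses as its cylinder masses. *)
pose nu1 : probability (borel (Sinf G)) R :=
  distribution nu (mfun_Sub (mem_set barG_measurable)).
exists chi', P', nu1; split=> // [m w|A _].
  by rewrite -E -nu_bar_cylinder.
rewrite /nu1 /distribution /pushforward /=; congr (nu _).
by apply/seteqP; split=> x /=; rewrite codingG_barG.
Qed.

End Coding.

Theorem theorem1p3 (R : realType) (q n : nat) (G : digraph n)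
  (J : Psi n -> set 'rV[R]_q)
  (s : Psi n -> Psi n -> R)
  (T : Psi n -> Psi n -> 'rV[R]_q -> 'rV[R]_q)
  (chi : 'rV[R]_(n.+2 + n.+2)) (P : 'M[R]_(n.+2 + n.+2))
  (nu : probability (borel (Ginf G)) R)
  (q_ge1 : (1 <= q)%N)
  (J_nonempty : forall i, J i !=set0)
  (J_compact : forall i, compact (J i))
  (J_regular : forall i, closure (interior (J i)) = J i)
  (J_disjoint : trivIset setT J)
  (T_similarity : forall i j : Psi n, [tuple i; j] \in Sword G 2 ->
     contractive_similarity (s i j) (T i j))
  (T_subset : forall i : Psi n,
     \bigcup_(j in [set j : Psi n | [tuple i; j] \in Sword G 2]) (T i j @` J j)
       `<=` J i)
  (T_disjoint : trivIset [set ij : Psi n * Psi n | [tuple ij.1; ij.2] \in Sword G 2]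
     (fun ij : Psi n * Psi n => T ij.1 ij.2 @` J ij.2))
  (chi_prob : probability_vector chi)
  (chi_gt0 : forall a, 0 < chi 0 a)
  (P_stochastic : row_stochastic P)
  (P_support : forall a b, (0 < P a b) = ([tuple a; b] \in Gword G 2))
  (nu_markov : Gmarkov chi P nu) :
  let mu : set (borel 'rV[R]_q) -> \bar R := pushforward nu (codingG T J) in
  let P1 := ulsubmx P in
  let P2 := drsubmx P in
  let P4 := dlsubmx P in
  let two_successors := forall i : Psi n,
    (2 <= #|[set j : Psi n | (0 < P (low i) (low j))%R]%SET|)%N /\
    (2 <= #|[set j : Psi n | (0 < P (high i) (high j))%R]%SET|)%N in
  (irreducible P1 -> two_successors ->
     (reducible G T J mu <->
      forall i : Psi n,
        (forall j : Psi n,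
           P (low i) (low j) + P (low i) (high j) =
           P (high i) (low j) + P (high i) (high j)) \/
        (forall m (w : m.+1.-tuple (Psi n)),
           w \in Sword G m.+1 -> tlast w = i ->
           chi 0 (high i) * I1 G chi P w = chi 0 (low i) * I2 G chi P w)))
  /\
  (irreducible P1 -> irreducible P2 -> P4 = 0 -> two_successors ->
     (forall i j : Psi n,
        Mset G i j = finset.set0 \/
        Mset G i j = [set [tuple low i; low j]; [tuple low i; high j];
                          [tuple high i; high j]]%SET) ->
     (reducible G T J mu <->
      forall i j : Psi n, [tuple i; j] \in Sword G 2 ->
        P (low i) (low j) + P (low i) (high j) = P (high i) (high j))).
Proof.
move=> mu P1 P2 P4 two_successors; have [Pge _] := P_stochastic.
have PE a b : (0 < P a b) = G a b by rewrite P_support inE /= andbT.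
have P0 a b : ~~ G a b -> P a b = 0.
  by rewrite -PE lt0r Pge andbT negbK => /eqP.
have red : reducible G T J mu <->
    forall i, sum_condition P i \/ ratio_condition G chi P i.
  rewrite /mu (reducible_liftmass J_nonempty J_compact J_disjoint T_similarity T_subset
    T_disjoint nu_markov).
  split; [exact: markov_condition|exact: condition_markov].
split=> [_ _|_ irr2 P40 two M3]; first exact: red.
(* A nonempty [Mset G i j] always contains the edge from [low i] to [high j]. *)
have M3_edges i j : [|| G (low i) (low j), G (low i) (high j), G (high i) (low j) |
    G (high i) (high j)] -> G (low i) (high j).
  have [M0|M] := M3 i j; last first.
    have : [tuple low i; high j] \in Mset G i j by rewrite M !inE eqxx orbT.
    by rewrite !inE => /andP[_ /=]; rewrite andbT.
  have notM t : t \notin Mset G i j by rewrite M0 inE.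
  have := notM [tuple low i; low j]; have := notM [tuple low i; high j].
  have := notM [tuple high i; low j]; have := notM [tuple high i; high j].
  by rewrite !inE !eqxx /= ?orbT /= !andbT => /negbTE-> /negbTE-> /negbTE-> /negbTE->.
(* Any lower successor [j] of [i] makes [Mset G i j] nonempty, which supplies an edge to the upper
   copy. *)
have leak i : exists j, 0 < P (low i) (high j).
  have [/ltnW/card_gt0P[j jP] _] := two i; move: jP; rewrite inE PE => Gij.
  by exists j; rewrite PE M3_edges // Gij.
rewrite red; split=> [H i j _|H i].
  have [/(_ j)->|] := H i; first by rewrite P_high_low // add0r.
  by move/(not_ratio_condition P0 chi_gt0 P_stochastic P40 irr2 leak).
left=> j; rewrite P_high_low // add0r.
(* Condition (a) ranges over all [j]; for a pair outside [Sword G 2] every entry over it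
   vanishes. *)
have [/H//|ijS] := boolP ([tuple i; j] \in Sword G 2).
have nG a b : bar a = i -> bar b = j -> P a b = 0.
  by move=> ai bj; apply: P0; apply: contra ijS; rewrite -ai -bj; exact: edge_admissible.
by rewrite !nG ?bar_low ?bar_high // addr0.
Qed.
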